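(* Let $\mathcal E$ be a discrete asymmetric information economy with commodity space a Banach lattice $Y$ and let $\mathcal E_c$ be the associated continuum economy. Assume: (Continuity) for all $i\in N$, $\omega\in\Omega$, $U_i(\omega,\cdot)$ is norm-continuous on $Y_+$; (Monotonicity) for all $i\in N$, $\omega\in\Omega$, if $x,y\in Y_+$ and $y>0$ then $U_i(\omega,x+y)>U_i(\omega,x)$; (Concavity) for all $i\in N$, $\omega\in\Omega$, $U_i(\omega,\cdot)$ is concave; (Strong positivity) for each $i\in N$, $\inf\{a_i(\omega):\omega\in\Omega\}>0$. Let $f$ be a feasible allocation in $\mathcal E_c$ such that $f(t,\cdot)=f_i$ for all $t\in I_i$ and $i\in N$. If $f$ is not in the private core of $\mathcal E_c$, then for any $0<\epsilon<1$ there is a coalition $S$ with $\mu(S)=\epsilon$ that privately blocks $f$.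
   Context: **Discrete economy.** $N=\{1,\dots,n\}$ is a finite set of agents; $(\Omega,\mathcal F)$ is a measurable space with $\Omega$ finite; $Y$ is a Banach lattice with positive cone $Y_+$. For $y\in Y$, $y>0$ means $y\ge 0$ and $y\neq 0$. A discrete economy $\mathcal E$ consists, for each $i\in N$, of a partition $\mathcal F_i$ of $\Omega$ (private information), a random utility $U_i:\Omega\times Y_+\to\mathbb R$, a random initial endowment $a_i:\Omega\to Y_+$ that is constant on elements of $\mathcal F_i$, and a prior $q_i$, a probability measure on $\Omega$ with $q_i(\omega)>0$ for all $\omega$. The ex ante expected utility is $V_i(x)=\sum_{\omega\in\Omega}U_i(\omega,x(\omega))q_i(\omega)$ for $x:\Omega\to Y_+$. A function on $\Omega$ is $\mathcal F_i$-measurable if it is constant on elements of $\mathcal F_i$; $L_i=\{x\in (Y_+)^\Omega: x \text{ is } \mathcal F_i\text{-measurable}\}$. **Continuum economy $\mathcal E_c$.** The agent space is $I=[0,1]$ with Lebesgue measure $\mu$, $I_i=[\frac{i-1}{n},\frac in)$ for $i<n$ and $I_n=[\frac{n-1}{n},1]$. Each $t\in I_i$ has $L_t=L_i$, $a(t,\cdot)=a_i$, $V_t=V_i$. An assignment is $f:I\times\Omega\to Y_+$ with $f(\cdot,\omega)$ Bochner integrable for every $\omega$; it is an allocation if $f(t,\cdot)\in L_t$ for almost all $t$; an allocation is feasible if $\int_I f(t,\omega)d\mu(t)\le\int_I a(t,\omega)d\mu(t)$ for all $\omega$. A coalition is a Borel set $S\subseteq I$ with $\mu(S)>0$. It privately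 blocks an allocation $f$ if there is $g:S\times\Omega\to Y_+$ (Bochner integrable in $t$ for each $\omega$) with $g(t,\cdot)\in L_t$ and $V_t(g(t,\cdot))>V_t(f(t,\cdot))$ for all $t\in S$ and $\int_S g(t,\omega)d\mu(t)\le\int_S a(t,\omega)d\mu(t)$ for all $\omega$. The private core of $\mathcal E_c$ is the set of feasible allocations not privately blocked by any coalition. *)

(* Defs.v *)
From HB Require Import structures.
From mathcomp Require Import all_boot all_order all_algebra.
From mathcomp Require Import all_classical all_reals all_analysis.

Set Implicit Arguments.
Unset Strict Implicit.
Unset Printing Implicit Defensive.

Import Order.TTheory GRing.Theory Num.Theory numFieldNormedType.Exports.

Local Open Scope classical_set_scope.
Local Open Scope ring_scope.

(** * Banach lattices *)

(* The order and the lattice operations are fields, not inherited structures,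
   because the hierarchy has no join between normed modules and ordered types
   above which the numeric types sit. The library's order and lattice
   structures are derived from these fields just below. *)
HB.mixin Record isBanachLattice (R : realType) Y
    of CompleteNormedModule R Y := {
  bl_le : rel Y ;
  bl_le_refl : reflexive bl_le ;
  bl_le_anti : antisymmetric bl_le ;
  bl_le_trans : transitive bl_le ;
  bl_meet : Y -> Y -> Y ;
  bl_join : Y -> Y -> Y ;
  bl_meetP : forall x y z, bl_le x (bl_meet y z) = bl_le x y && bl_le x z ;
  bl_joinP : forall x y z, bl_le (bl_join x y) z = bl_le x z && bl_le y z ;
  bl_leD2r : forall z x y, bl_le x y -> bl_le (x + z) (y + z) ;
  bl_scaler_ge0 : forall (a : R) x, 0 <= a -> bl_le 0 x -> bl_le 0 (a *: x) ;
  (* [bl_join x (- x)] is the lattice modulus of [x] *)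
  bl_le_norm : forall x y : Y,
    bl_le (bl_join x (- x)) (bl_join y (- y)) -> `|x| <= `|y|
}.

#[short(type="banachLatticeType")]
HB.structure Definition BanachLattice (R : realType) :=
  { Y of isBanachLattice R Y & CompleteNormedModule R Y }.

HB.instance Definition _ (R : realType) (Y : banachLatticeType R) :=
  Order.Le_isPOrder.Build ring_display (BanachLattice.sort Y)
    (@bl_le_refl R Y) (@bl_le_anti R Y) (@bl_le_trans R Y).

HB.instance Definition _ (R : realType) (Y : banachLatticeType R) :=
  Order.POrder_MeetJoin_isLattice.Build ring_display (BanachLattice.sort Y)
    (@bl_meetP R Y) (@bl_joinP R Y).

(** * Bochner integral *)

Section bochner.
Context d (T : measurableType d) (R : realType) (Y : completeNormedModType R).
Variables (mu : {measure set T -> \bar R}) (D : set T).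

Definition integrable_simple (s : {fimfun T >-> Y}) :=
  forall y, measurable (D `&` s @^-1` [set y]) /\
    (y != 0 -> (mu (D `&` s @^-1` [set y]) < +oo)%E).

Definition simple_integral (s : {fimfun T >-> Y}) : Y :=
  \sum_(y \in range s) fine (mu (D `&` s @^-1` [set y])) *: y.

Definition bochner_approx (f : T -> Y) (s : nat -> {fimfun T >-> Y}) :=
  [/\ forall k, integrable_simple (s k),
      {ae mu, forall t, D t -> s k t @[k --> \oo] --> f t} &
      (\int[mu]_(t in D) `|f t - s k t|%:E)%E @[k --> \oo] --> 0%E].

Definition bochner_integrable (f : T -> Y) :=
  exists s, bochner_approx f s.

(* The default 0 is returned only when [f] is not integrable: for integrable
   [f] the limit exists by completeness and does not depend on [s]. *)
Definition bochner_integral (f : T -> Y) : Y :=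
  xget 0 [set v | exists2 s, bochner_approx f s &
                    simple_integral (s k) @[k --> \oo] --> v].

End bochner.

(** * Discrete economy *)

(* There are [n.+1] agents, so that the set of agents is nonempty. Utilities
   are total functions on [Y]; only their values on the positive cone are ever
   used. Since every state has positive prior probability, every singleton is
   an event, so [Omega] carries all its subsets as events and a prior is given
   by its mass function. *)
Record economy (R : realType) (Y : banachLatticeType R) (Omega : finType)
    (n : nat) := Economy {
  info : 'I_n.+1 -> {set {set Omega}} ;
  info_partition : forall i, finset.partition (info i) [set: Omega]%SET ;
  utility : 'I_n.+1 -> Omega -> Y -> R ;
  endow : 'I_n.+1 -> Omega -> Y ;
  endow_ge0 : forall i w, 0 <= endow i w ;
  endow_info : forall i (B : {set Omega}), B \in info i ->
    {in B &, forall w w', endow i w = endow i w'} ;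
  prior : 'I_n.+1 -> Omega -> R ;
  prior_gt0 : forall i w, 0 < prior i w ;
  prior_sum1 : forall i, \sum_w prior i w = 1
}.

Section discrete_economy.
Context (R : realType) (Y : banachLatticeType R) (Omega : finType) (n : nat).
Variable E : economy Y Omega n.
Implicit Types (i : 'I_n.+1) (w : Omega) (x : Omega -> Y).

Definition ex_ante i x : R := \sum_w utility E i w (x w) * prior E i w.

Definition info_measurable i x :=
  forall B : {set Omega}, B \in info E i -> {in B &, forall w w', x w = x w'}.

Definition consumption_set i : set (Omega -> Y) :=
  [set x | (forall w, 0 <= x w) /\ info_measurable i x].

Definition continuity := forall i w,
  {within [set y : Y | 0 <= y], continuous (utility E i w)}.

Definition monotonicity := forall i w (x y : Y),
  0 <= x -> 0 < y -> utility E i w x < utility E i w (x + y).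

Definition concavity := forall i w (x y : Y) (l : R),
  0 <= x -> 0 <= y -> 0 <= l <= 1 ->
  l * utility E i w x + (1 - l) * utility E i w y
    <= utility E i w (l *: x + (1 - l) *: y).

Definition strong_positivity := forall i, 0 < infimum 0 (range (endow E i)).

End discrete_economy.

(** * Associated continuum economy *)

Section continuum_economy.
Context (R : realType) (Y : banachLatticeType R) (Omega : finType) (n : nat).
Variable E : economy Y Omega n.
Implicit Types (t : R) (w : Omega) (f g : R -> Omega -> Y) (S : set R).

Let mu : {measure set (measurableTypeR R) -> \bar R} := lebesgue_measure.

Definition agents : set R := `[0, 1].

Definition agents_of_type (i : 'I_n.+1) : set R :=
  if i == ord_max then `[i%:R / n.+1%:R, 1]%classic
  else `[i%:R / n.+1%:R, i.+1%:R / n.+1%:R[%classic.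

(* The sets [agents_of_type i] partition [agents], so for [t] in [agents] this
   is the unique type of [t]; outside [agents] it is irrelevant. *)
Definition type_of t : 'I_n.+1 := xget ord0 [set i | agents_of_type i t].

Definition c_consumption_set t := consumption_set E (type_of t).
Definition c_endow t := endow E (type_of t).
Definition c_ex_ante t := ex_ante E (type_of t).

Definition assignment f :=
  (forall t w, agents t -> 0 <= f t w) /\
  (forall w, bochner_integrable mu agents (f ^~ w)).

Definition allocation f :=
  assignment f /\ {ae mu, forall t, agents t -> c_consumption_set t (f t)}.

Definition feasible f := forall w,
  bochner_integral mu agents (f ^~ w)
    <= bochner_integral mu agents (c_endow ^~ w).

(* On [measurableTypeR R] the measurable sets are the Borel sets. *)
Definition coalition S :=
  [/\ measurable (S : set (measurableTypeR R)), S `<=` agents &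
      (0 < mu S)%E].

(* Only the values of [g] on [S] matter. *)
Definition privately_blocks S f :=
  coalition S /\ exists g,
    [/\ forall w, bochner_integrable mu S (g ^~ w),
        forall t, S t -> c_consumption_set t (g t),
        forall t, S t -> c_ex_ante t (f t) < c_ex_ante t (g t) &
        forall w, bochner_integral mu S (g ^~ w)
                    <= bochner_integral mu S (c_endow ^~ w)].

Definition private_core : set (R -> Omega -> Y) :=
  [set f | [/\ allocation f, feasible f &
               forall S, ~ privately_blocks S f]].

End continuum_economy.

(* Main.v *)
Require Import Defs.
From HB Require Import structures.
From mathcomp Require Import all_boot all_order all_algebra finmap ring lra.
From mathcomp Require Import all_classical all_reals all_analysis.
From mathcomp Require Import measurable_realfun.
Import Order.TTheory GRing.Theory Num.Theory numFieldNormedType.Exports.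
Local Open Scope classical_set_scope.
Local Open Scope ring_scope.

(** Let [S0] be a coalition that blocks [f] by means of [g0]. Only the sizes
    [s i] of its parts of each type and the means [v i] of [g0] over these parts
    matter. By Jensen's inequality the mean of a family of bundles that are all
    strictly better than [fi i] is still strictly better than [fi i], it is
    positive and measurable for the information of the type, and the resource
    constraint of [S0] reads [\sum_i s i *: v i <= \sum_i s i *: a i], where
    [a i] is the endowment ([blocking_averages]).

    This finite datum can be given any size [eps < 1] ([blocking_any_size]).
    Concavity leaves room to replace [v i] by [(1 - e) *: v i], and strong
    positivity turns what is saved into a surplus of at least a fixed [z > 0]
    in every state. Now take a coalition with [alpha * s i + beta / (n + 1)]
    agents of type [i], where [alpha] and [beta] are positive: a share
    [alpha * s i] consumes the scaled down plan, and a share [beta / (n + 1)],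
    which is the same for all types, consumes [fi i] plus an equal part of the
    surplus. Feasibility of [f] makes the second share affordable. Both shares
    are strictly better off than at [fi i], by the blocking property and by
    monotonicity, so the average of the two plans within a type is so too, by
    concavity. The total size is [alpha * \sum_i s i + beta], which reaches
    every [eps < 1] as soon as [alpha] is small. A coalition with prescribed
    sizes is a union of initial segments of the intervals of types
    ([initial_coalition]).

    The analytic part is the theory of the Bochner integral that this needs:
    approximating simple functions have convergent integrals
    ([bochner_integral_cvg]), the integral is additive over a finite partition
    ([bochner_integral_fibers]) and positive, and Jensen's inequality holds.
    The approximating simple functions may leave the positive cone, on which
    alone the utilities are controlled; composing them with the positive part,
    which is 1-Lipschitz in a Banach lattice, brings them back. Jensen's
    inequality then follows from the finite one by Fatou's lemma, one state at
    a time ([integral_jensen], [strict_jensen]). *)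

Set Implicit Arguments.
Unset Strict Implicit.

(** * Simple functions *)

Section simple_functions.
Context d (T : measurableType d) (R : realType).
Variable mu : {measure set T -> \bar R}.

(** Stated for functions with values in any type, so that several simple
    functions can be paired and handled on common fibres. *)
Definition simple_on (Z : Type) (D : set T) (s : T -> Z) :=
  forall z, measurable (D `&` s @^-1` [set z]).

Definition level (Z : Type) (D : set T) (s : T -> Z) (z : Z) : R :=
  fine (mu (D `&` s @^-1` [set z])).

Lemma simple_on_preimage (Z : choiceType) D (s : {fimfun T >-> Z}) (P : set Z) :
  simple_on D s -> measurable (D `&` s @^-1` P).
Proof.
move=> sD.
have -> : D `&` s @^-1` P =
    \bigcup_(z in range s `&` P) (D `&` s @^-1` [set z]).
  apply/seteqP; split=> [t [Dt Pt]|t [z [_ Pz] [Dt /= st]]].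
    by exists (s t) => //; split => //; exists t.
  by split => //; rewrite /= st.
by apply: fin_bigcup_measurable => //; exact: finite_setIl.
Qed.

Lemma simple_on_measurable (Z : choiceType) D (s : {fimfun T >-> Z})
    d' (W : measurableType d') (phi : Z -> W) :
  simple_on D s -> measurable_fun D (phi \o s).
Proof.
by move=> sD _ B _; rewrite comp_preimage; exact: simple_on_preimage.
Qed.

Lemma simple_on_comp (Z W : choiceType) D (s : {fimfun T >-> Z})
    (phi : Z -> W) :
  simple_on D s -> simple_on D (phi \o s).
Proof. by move=> sD w; rewrite comp_preimage; exact: simple_on_preimage. Qed.

Lemma simple_on_sub (Z : Type) D D' (s : T -> Z) :
  measurable D' -> D' `<=` D -> simple_on D s -> simple_on D' s.
Proof.
move=> mD' D'D sD z; rewrite -(setIidl D'D) -setIA.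
by apply: measurableI.
Qed.

Definition pair_fun (Z W : Type) (s : T -> Z) (s' : T -> W) (t : T) :=
  (s t, s' t).

Lemma pair_fimfun_subproof (Z W : Type) (s : {fimfun T >-> Z})
    (s' : {fimfun T >-> W}) : @FiniteImage T (Z * W)%type (pair_fun s s').
Proof. by split; apply: (finite_image11 (fun x y => (x, y))). Qed.
HB.instance Definition _ (Z W : Type) (s : {fimfun T >-> Z})
    (s' : {fimfun T >-> W}) := @pair_fimfun_subproof Z W s s'.

Lemma simple_on_pair (Z W : choiceType) D (s : {fimfun T >-> Z})
    (s' : {fimfun T >-> W}) :
  simple_on D s -> simple_on D s' -> simple_on D (pair_fun s s').
Proof.
move=> sD sD' [z w].
rewrite (_ : _ `&` _ = (D `&` s @^-1` [set z]) `&` (D `&` s' @^-1` [set w])).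
  exact: measurableI.
by apply/seteqP; split=> t /= [] => [Dt [<- <-]|[Dt <-] [_ <-]].
Qed.

Section finite_measure.
Variables (D : set T) (mD : measurable D) (fD : (mu D < +oo)%E).

Lemma level_ge0 (Z : Type) (s : T -> Z) z : 0 <= level D s z.
Proof. exact/fine_ge0. Qed.

Lemma fin_num_sub A : measurable A -> A `<=` D -> mu A \is a fin_num.
Proof.
move=> mA AD; rewrite ge0_fin_numE//; apply: le_lt_trans fD.
by apply: le_measure => //; rewrite inE.
Qed.

Lemma levelK (Z : Type) (s : T -> Z) z : simple_on D s ->
  mu (D `&` s @^-1` [set z]) = (level D s z)%:E.
Proof. by move=> sD; rewrite fineK//; apply: fin_num_sub => // t []. Qed.

Lemma integral_simple (Z : choiceType) (s : {fimfun T >-> Z}) (phi : Z -> R) :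
  simple_on D s -> (forall z, 0 <= phi z) ->
  (\int[mu]_(t in D) (phi (s t))%:E
   = (\sum_(z <- fset_set (range s)) level D s z * phi z)%:E)%E.
Proof.
move=> sD phi0.
have DE : D = \big[setU/set0]_(z <- fset_set (range s)) (D `&` s @^-1` [set z]).
  rewrite -bigcup_fset; apply/seteqP; split=> [t Dt|t [z _ []]//].
  exists (s t) => //=; by rewrite in_fset_set// inE; exists t.
rewrite {1}DE ge0_integral_bigsetU//=.
- rewrite -sumEFin; apply: eq_bigr => z _.
  rewrite (eq_integral (cst (phi z)%:E)).
    by rewrite integral_cst// levelK// -EFinM mulrC.
  by move=> t; rewrite inE => -[_ /= <-].
- by apply/trivIsetP => z w _ _ zw; apply/seteqP; split=> t //= [[_ zs] [_ ws]];
    rewrite -zs ws eqxx in zw.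
- rewrite -DE; apply/measurable_EFinP.
  exact: (@simple_on_measurable _ _ s _ _ phi).
- by move=> t _; rewrite lee_fin.
Qed.

(** This is [integral_simple] for the indicator of [P]. *)
Lemma fine_measure_simple (Z : choiceType) (s : {fimfun T >-> Z}) (P : pred Z) :
  simple_on D s ->
  fine (mu (D `&` s @^-1` [set z | P z]))
  = \sum_(z <- fset_set (range s) | P z) level D s z.
Proof.
move=> sD; apply: EFin_inj; rewrite fineK; last first.
  by apply: fin_num_sub; [exact: simple_on_preimage|move=> t []].
transitivity (\int[mu]_(t in D) ((P (s t))%:R)%:E)%E.
  have mP := simple_on_preimage [set z | P z] sD.
  rewrite (eq_integral (fun t => (\1_(D `&` s @^-1` [set z | P z]) t)%:E)).
    by rewrite integral_indic// setIAC setIid.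
  move=> t; rewrite inE => Dt; rewrite indicE; congr ((nat_of_bool _)%:R%:E).
  by apply/idP/idP; rewrite inE /= => // -[].
rewrite (integral_simple (phi := fun z => (P z)%:R))//.
congr EFin; rewrite [RHS]big_mkcond.
by apply: eq_bigr => z _; case: (P z); rewrite ?mulr1 ?mulr0.
Qed.

Lemma sum_level (Z : choiceType) (s : {fimfun T >-> Z}) : simple_on D s ->
  \sum_(z <- fset_set (range s)) level D s z = fine (mu D).
Proof.
move=> sD; rewrite -(fine_measure_simple predT sD); congr (fine (mu _)).
by apply/seteqP; split=> t // [].
Qed.

End finite_measure.
End simple_functions.

(** * Limits of integrals of simple functions *)

Section bochner_limits.
Context d (T : measurableType d) (R : realType) (Y : completeNormedModType R).
Variable mu : {measure set T -> \bar R}.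
Implicit Types (D : set T) (f : T -> Y) (s : nat -> {fimfun T >-> Y}).

(** The integrand [`|f t - s k t|] in the definition of the Bochner integral
    need not be measurable, since [f] is only an almost everywhere limit. Its
    integral is then a lower integral, which additivity fails for in general
    but which is still monotone. *)
Lemma le_lower_integral D D' (f g : T -> \bar R) : D' `<=` D ->
  (forall t, D t -> 0 <= g t)%E -> (forall t, D' t -> 0 <= f t)%E ->
  (forall t, D' t -> f t <= g t)%E ->
  (\int[mu]_(t in D') f t <= \int[mu]_(t in D) g t)%E.
Proof.
move=> D'D g0 f0 fg; rewrite integral_mkcond [leRHS]integral_mkcond.
rewrite !ge0_integralTE; try by apply: erestrict_ge0.
apply: le_ereal_sup => _ [h hf <-]; exists h => // t.
apply: le_trans (hf t) _; rewrite /patch; case: ifPn => [|_].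
  by rewrite inE => D't; rewrite mem_set ?fg//; exact: D'D.
by case: ifPn => //; rewrite inE; exact: g0.
Qed.

Lemma approx_simple D f s k : bochner_approx mu D f s -> simple_on D (s k).
Proof. by case=> sI _ _ z; case: (sI k z). Qed.

Section finite_measure.
Variables (D : set T) (mD : measurable D) (fD : (mu D < +oo)%E).

(** Grouping the fibres of [s] according to the value of [phi] gives those of
    [phi \o s]. *)
Lemma simple_integral_comp (Z : choiceType) (s : {fimfun T >-> Z})
    (phi : Z -> Y) : simple_on D s ->
  simple_integral mu D (phi \o s)
  = \sum_(z <- fset_set (range s)) level mu D s z *: phi z.
Proof.
move=> sD; rewrite /simple_integral -(image_comp s phi) fsbig_finite/=;
  last exact: finite_image.
rewrite fset_set_image// (partition_big_imfset _ phi)/=.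
apply: eq_bigr => y _; under [RHS]eq_bigr => z /eqP -> do over.
rewrite -scaler_suml; congr (_ *: _).
rewrite -(fine_measure_simple mD fD (fun z => phi z == y))//.
by congr (fine (mu _)); apply/seteqP; split=> t [Dt /= /eqP].
Qed.

(** On the fibres of the pair [(s, s')] both functions are constant. *)
Lemma simple_integralB_le (s s' : {fimfun T >-> Y}) :
  simple_on D s -> simple_on D s' ->
  (`|simple_integral mu D s - simple_integral mu D s'|%:E
   <= \int[mu]_(t in D) `|s t - s' t|%:E)%E.
Proof.
move=> sD s'D; have pD := simple_on_pair sD s'D.
have -> : simple_integral mu D s
    = simple_integral mu D (fst \o pair_fun s s').
  by congr simple_integral; apply/fimfuneqP.
have -> : simple_integral mu D s'
    = simple_integral mu D (snd \o pair_fun s s').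
  by congr simple_integral; apply/fimfuneqP.
rewrite !simple_integral_comp// -sumrB.
rewrite (integral_simple mD fD (phi := fun z : Y * Y => `|z.1 - z.2|) pD)//.
rewrite lee_fin (le_trans (ler_norm_sum _ _ _))//; apply: ler_sum => z _.
by rewrite -scalerBr normrZ ger0_norm// level_ge0.
Qed.

Lemma approx_cvg_off_null f s : bochner_approx mu D f s ->
  exists N, [/\ measurable N, mu N = 0%E &
    forall t, (D `\` N) t -> s k t @[k --> \oo] --> f t].
Proof.
move=> [_ [N [mN N0 subN]] _]; exists N; split=> // t [Dt Nt].
by apply: contrapT => nst; apply/Nt/subN => /= /(_ Dt).
Qed.

(** Off the null set where convergence fails, the distance from [f] to a simple
    function is a pointwise limit of measurable functions. *)
Lemma measurable_dist_simple D' f s (u : {fimfun T >-> Y}) :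
  measurable D' -> D' `<=` D -> (forall k, simple_on D (s k)) ->
  simple_on D u -> (forall t, D' t -> s k t @[k --> \oo] --> f t) ->
  measurable_fun D' (fun t => `|f t - u t|%:E).
Proof.
move=> mD' D'D sD uD sf; apply/measurable_EFinP.
apply: (measurable_fun_cvg (h := fun k t => `|s k t - u t|)) => [k|t D't].
  have /(simple_on_sub mD' D'D) pD := simple_on_pair (sD k) uD.
  exact: (simple_on_measurable (fun z : Y * Y => `|z.1 - z.2|) pD).
by apply: cvg_norm; apply: cvgB; [exact: sf|exact: cvg_cst].
Qed.

(** The triangle inequality may fail for lower integrals, so it is applied
    off a null set, where the integrands are measurable; the passage back to
    [D] uses monotonicity only. *)
Lemma approx_dist f s s' k j : bochner_approx mu D f s ->
  bochner_approx mu D f s' ->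
  (`|simple_integral mu D (s k) - simple_integral mu D (s' j)|%:E
   <= \int[mu]_(t in D) `|f t - s k t|%:E
      + \int[mu]_(t in D) `|f t - s' j t|%:E)%E.
Proof.
move=> fs fs'; have [N [mN N0 sf]] := approx_cvg_off_null fs.
have sD i : simple_on D (s i) := approx_simple i fs.
have s'D i : simple_on D (s' i) := approx_simple i fs'.
have mD' : measurable (D `\` N) by exact: measurableD.
have D'D : D `\` N `<=` D by exact: subDsetl.
apply: (le_trans (simple_integralB_le (sD k) (s'D j))).
rewrite (ge0_negligible_integral mN mD)//; last first.
  apply/measurable_EFinP; have pD := simple_on_pair (sD k) (s'D j).
  exact: (simple_on_measurable (fun z : Y * Y => `|z.1 - z.2|) pD).
apply: (@le_trans _ _ (\int[mu]_(t in D `\` N)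
    (`|f t - s k t|%:E + `|f t - s' j t|%:E))%E).
  apply: le_lower_integral => // t _; first by rewrite adde_ge0 ?lee_fin.
  by rewrite -EFinD lee_fin (distrC (f t) (s k t)) ler_distD.
rewrite ge0_integralD//; try exact: (measurable_dist_simple (s := s)).
by apply: leeD; exact: le_lower_integral.
Qed.

Lemma approx_small f s (e : R) : 0 < e -> bochner_approx mu D f s ->
  \forall k \near \oo, (\int[mu]_(t in D) `|f t - s k t|%:E < e%:E)%E.
Proof.
move=> e0 [_ _ /(_ [set x | (x < e%:E)%E])]; apply.
exact: open_ereal_lt_ereal.
Qed.

Lemma approx_dist_small f s s' (e : R) : 0 < e -> bochner_approx mu D f s ->
  bochner_approx mu D f s' ->
  \forall k \near \oo, \forall j \near \oo,
    `|simple_integral mu D (s k) - simple_integral mu D (s' j)| < e.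
Proof.
move=> e0 fs fs'; have e20 : 0 < e / 2 by rewrite divr_gt0.
near=> k; near=> j; rewrite -lte_fin (le_lt_trans (approx_dist k j fs fs'))//.
rewrite [e]splitr EFinD lteD//; last by near: j; exact: approx_small.
by near: k; exact: approx_small.
Unshelve. all: by end_near. Qed.

(** By [approx_dist] the integrals of an approximating sequence are Cauchy, and
    two approximating sequences of [f] have the same limit, so the value chosen
    in [bochner_integral] is the limit for every sequence. *)
Lemma bochner_integral_cvg f s : bochner_approx mu D f s ->
  simple_integral mu D (s k) @[k --> \oo] --> bochner_integral mu D f.
Proof.
move=> fs.
have /cauchy_cvg cs : cauchy (simple_integral mu D (s k) @[k --> \oo]).
  apply: cauchy_exP => e e0.
  have [k ks] := filter_ex (approx_dist_small e0 fs fs).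
  exists (simple_integral mu D (s k)).
  by move: ks; apply: filterS => j; rewrite -ball_normE.
have [s' fs' s'v] : exists2 s', bochner_approx mu D f s' &
    simple_integral mu D (s' k) @[k --> \oo] --> bochner_integral mu D f.
  apply: (@xgetPex _ _ [set v | exists2 s, bochner_approx mu D f s &
    simple_integral mu D (s k) @[k --> \oo] --> v]).
  by eexists; exists s; [exact: fs|exact: cs].
set v := bochner_integral mu D f in s'v *.
apply/cvgrPdist_lt => e e0; have e20 : 0 < e / 2 by rewrite divr_gt0.
near=> k.
have [j [jk jv]] : exists j,
    `|simple_integral mu D (s k) - simple_integral mu D (s' j)| < e / 2 /\
    `|v - simple_integral mu D (s' j)| < e / 2.
  apply: (@filter_ex _ \oo); apply: filterI.
    by near: k; exact: (approx_dist_small e20 fs fs').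
  by move/cvgrPdist_lt: s'v; exact.
rewrite (le_lt_trans (ler_distD (simple_integral mu D (s' j)) _ _))//.
by rewrite [e]splitr ltrD// distrC.
Unshelve. all: by end_near. Qed.

End finite_measure.
End bochner_limits.

(** * The Bochner integral and finite partitions of its domain *)

Section bochner_domains.
Context d (T : measurableType d) (R : realType) (Y : completeNormedModType R).
Variable mu : {measure set T -> \bar R}.
Variables (D : set T) (mD : measurable D) (fD : (mu D < +oo)%E).
Implicit Types (f : T -> Y) (s : nat -> {fimfun T >-> Y}).

Lemma simple_on_integrable (s : {fimfun T >-> Y}) :
  simple_on D s -> integrable_simple mu D s.
Proof.
move=> sD y; split=> // _; apply: le_lt_trans fD.
by apply: le_measure => //; rewrite inE.
Qed.

Lemma approx_eq f g s : (forall t, D t -> f t = g t) ->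
  bochner_approx mu D f s -> bochner_approx mu D g s.
Proof.
move=> fg [sI sf s0]; split=> //.
  by apply: filterS sf => t + Dt => /(_ Dt); rewrite fg.
rewrite (_ : (fun k => _) = (fun k => \int[mu]_(t in D) `|f t - s k t|%:E)%E)//.
by apply/funext => k; apply: eq_integral => t; rewrite inE => Dt; rewrite fg.
Qed.

Lemma eq_bochner_integral f g : (forall t, D t -> f t = g t) ->
  bochner_integral mu D f = bochner_integral mu D g.
Proof.
move=> fg; rewrite /bochner_integral; congr (xget _ _); apply/seteqP.
by split=> v [s fs sv]; exists s => //; apply: approx_eq fs => t Dt; rewrite fg.
Qed.

Lemma le_approx f g s s' : bochner_approx mu D f s ->
  (forall k, simple_on D (s' k)) ->
  (forall t k, D t -> `|g t - s' k t| <= `|f t - s k t|) ->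
  bochner_approx mu D g s'.
Proof.
move=> [sI sf s0] s'D le; split.
- by move=> k; exact: simple_on_integrable.
- apply: filterS sf => t sf Dt; apply/cvgrPdist_lt => e e0.
  have /cvgrPdist_lt/(_ e e0) := sf Dt.
  by apply: filterS => k; apply: le_lt_trans; exact: le.
- apply: (squeeze_cvge _ (cvg_cst _) s0); apply: nearW => k.
  rewrite integral_ge0//=.
  by apply: le_lower_integral => // t Dt; rewrite lee_fin// le.
Qed.

Lemma simple_bochner_integral (s : {fimfun T >-> Y}) : simple_on D s ->
  bochner_integrable mu D s /\ bochner_integral mu D s = simple_integral mu D s.
Proof.
move=> sD; have ss : bochner_approx mu D s (fun=> s).
  split; first by move=> _; exact: simple_on_integrable.
    by apply: aeW => t _; exact: cvg_cst.
  rewrite (_ : (fun k => _) = cst 0%E); first exact: cvg_cst.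
  apply/funext => k; apply: integral0_eq => t _; by rewrite subrr normr0.
split; first by exists (fun=> s).
have := @bochner_integral_cvg _ _ _ _ _ _ mD fD _ _ ss.
by move/cvg_lim => <-//; rewrite lim_cst.
Qed.

Lemma approx_sub D' f s : measurable D' -> D' `<=` D ->
  bochner_approx mu D f s -> bochner_approx mu D' f s.
Proof.
move=> mD' D'D [sI sf s0]; split.
- move=> k y; have [my fy] := sI k y; split.
    by rewrite -(setIidl D'D) -setIA; exact: measurableI.
  move=> /fy; apply: le_lt_trans; apply: le_measure; rewrite ?inE//.
    by rewrite -(setIidl D'D) -setIA; exact: measurableI.
  exact: setSI.
- by apply: filterS sf => t + /D'D; apply.
- apply: (squeeze_cvge _ (cvg_cst _) s0); apply: nearW => k.
  rewrite integral_ge0//=.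
  by apply: le_lower_integral => // t D't; rewrite lee_fin.
Qed.

Section types.
Variables (I : finType) (tau : T -> I).
Hypothesis tauD : simple_on D tau.

Lemma finType_fimfun_subproof : @FiniteImage T I tau.
Proof. by split; exact: finite_finset. Qed.
HB.instance Definition _ := finType_fimfun_subproof.

Definition fiber i := D `&` tau @^-1` [set i].

Lemma measurable_fiber i : measurable (fiber i). Proof. exact: tauD. Qed.

Lemma sum_range_fiber (V : lmodType R) (v : I -> V) :
  \sum_(i <- fset_set (range tau)) level mu D tau i *: v i
  = \sum_i fine (mu (fiber i)) *: v i.
Proof.
rewrite [RHS](bigID [in fset_set (range tau)])/= [X in _ + X]big1 ?addr0.
  by rewrite big_uniq ?fset_uniq.
move=> i; rewrite in_fset_set// notin_setE => itau.
rewrite (_ : fiber i = set0) ?measure0 ?scale0r//.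
by apply/seteqP; split=> t //= [_ ti]; apply: itau; exists t.
Qed.

Lemma measure_fibers : fine (mu D) = \sum_i fine (mu (fiber i)).
Proof.
have := sum_range_fiber (fun=> 1 : R^o).
under eq_bigr do rewrite [_ *: _]mulr1; rewrite sum_level// => ->.
by apply: eq_bigr => i _; exact: mulr1.
Qed.

(** A function of [tau] alone is simple, hence approximated by itself. *)
Lemma bochner_integral_step f (v : I -> Y) :
  (forall t, D t -> f t = v (tau t)) ->
  bochner_integrable mu D f /\
  bochner_integral mu D f = \sum_i fine (mu (fiber i)) *: v i.
Proof.
move=> fv.
have vD : simple_on D (v \o tau) := simple_on_comp (s := tau) v tauD.
have [[s vs] vi] := simple_bochner_integral vD.
split; first by exists s; apply: approx_eq vs => t Dt; rewrite fv.
rewrite (eq_bochner_integral fv) vi simple_integral_comp//.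
exact: sum_range_fiber.
Qed.

(** Additivity holds for simple functions on the fibres of the pair
    [(s k, tau)], and a sequence that approximates [f] on [D] does so on each
    fibre of [tau]. *)
Lemma bochner_integral_fibers f : bochner_integrable mu D f ->
  bochner_integral mu D f = \sum_i bochner_integral mu (fiber i) f.
Proof.
move=> [s fs].
have fiberD i : fiber i `<=` D by move=> t [].
have ffiber i : (mu (fiber i) < +oo)%E.
  apply: le_lt_trans fD; apply: le_measure => //; rewrite inE//.
  exact: measurable_fiber.
have siE k : simple_integral mu D (s k)
    = \sum_i simple_integral mu (fiber i) (s k).
  have sD : simple_on D (s k) := approx_simple k fs.
  have pD := simple_on_pair (s' := tau) sD tauD.
  have -> : simple_integral mu D (s k)
      = simple_integral mu D (fst \o pair_fun (s k) tau).
    by congr simple_integral; exact/fimfuneqP.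
  rewrite simple_integral_comp//.
  have sfiber i : simple_integral mu (fiber i) (s k)
      = \sum_(z <- fset_set (range (pair_fun (s k) tau)))
          level mu (fiber i) (pair_fun (s k) tau) z *: z.1.
    have pDi := simple_on_sub (measurable_fiber i) (fiberD i) pD.
    rewrite -(simple_integral_comp (measurable_fiber i) (ffiber i) fst pDi).
    by congr simple_integral; exact/fimfuneqP.
  under [RHS]eq_bigr do rewrite sfiber.
  rewrite exchange_big/=; apply: eq_bigr => -[y j] _ /=.
  rewrite (bigD1 j)//= big1 ?addr0 => [|i ij].
    congr (fine (mu _) *: _); apply/seteqP; split=> t /= [].
      by move=> Dt [yt jt]; split; [split|rewrite /pair_fun yt jt].
    by move=> [Dt _] [yt jt]; split; [|rewrite /pair_fun yt jt].
  rewrite /level (_ : _ `&` _ = set0) ?measure0 ?scale0r//.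
  apply/seteqP; split=> t //= [[Dt it] [_ jt]].
  by move: ij; rewrite -it -jt eqxx.
have : simple_integral mu D (s k) @[k --> \oo] -->
    \sum_i bochner_integral mu (fiber i) f.
  rewrite (funext siE); apply: cvg_big => [|i _]; first exact: add_continuous.
  apply: bochner_integral_cvg => //; first exact: measurable_fiber.
  by apply: approx_sub fs => //; exact: measurable_fiber.
by move/cvg_lim => <-//; apply/esym/cvg_lim => //; exact: bochner_integral_cvg.
Qed.

End types.

Lemma bochner_integral_null f : mu D = 0%E -> bochner_integrable mu D f ->
  bochner_integral mu D f = 0.
Proof.
move=> D0 [s fs]; have := bochner_integral_cvg mD fD fs.
rewrite (_ : (fun k => _) = cst 0).
  by move/cvg_lim => <-//; rewrite lim_cst.
apply/funext => k; have sD := approx_simple k fs.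
rewrite (_ : s k = id \o s k) ?simple_integral_comp//; last exact/fimfuneqP.
rewrite big1// => z _.
by rewrite /level (@subset_measure0 _ _ _ mu _ D) ?scale0r.
Qed.

End bochner_domains.

(** * Order and norm in a Banach lattice *)

Section banach_lattice.
Context (R : realType) (Y : banachLatticeType R).
Implicit Types (x y z : Y) (a : R).

(** The axioms of the structure concern [bl_le]; restated for the order derived
    from it, they combine with the general lemmas on orders. *)
Lemma bl_le_add2r z x y : x <= y -> x + z <= y + z.
Proof. exact: bl_leD2r. Qed.

Lemma bl_leD x y z t : x <= y -> z <= t -> x + z <= y + t.
Proof.
move=> xy zt; apply: le_trans (bl_le_add2r z xy) _.
by rewrite ![y + _]addrC; exact: bl_le_add2r.
Qed.

Lemma bl_subr_ge0 x y : (0 <= y - x) = (x <= y).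
Proof.
apply/idP/idP => [|xy]; last by rewrite -(subrr x); exact: bl_le_add2r.
by move=> /(bl_le_add2r x); rewrite add0r subrK.
Qed.

Lemma bl_addr_ge0 x y : 0 <= x -> 0 <= y -> 0 <= x + y.
Proof. by move=> x0 y0; rewrite -[0]addr0; exact: bl_leD. Qed.

Lemma bl_scale_ge0 a x : 0 <= a -> 0 <= x -> 0 <= a *: x.
Proof. exact: bl_scaler_ge0. Qed.

Lemma bl_scale_gt0 a x : 0 < a -> 0 < x -> 0 < a *: x.
Proof.
move=> a0; rewrite !lt_def => /andP[xN0 x0].
rewrite bl_scale_ge0 ?(ltW a0)// andbT; apply/eqP => ax0; move/eqP: xN0; apply.
by rewrite -(scalerK (lt0r_neq0 a0) x) ax0 scaler0.
Qed.

Lemma bl_scale_le a x y : 0 <= a -> x <= y -> a *: x <= a *: y.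
Proof.
by move=> a0 xy; rewrite -bl_subr_ge0 -scalerBr bl_scale_ge0// bl_subr_ge0.
Qed.

Lemma bl_sum_ge0 (I : Type) (r : seq I) (P : pred I) (F : I -> Y) :
  (forall i, P i -> 0 <= F i) -> 0 <= \sum_(i <- r | P i) F i.
Proof. by move=> F0; elim/big_ind: _ => //; exact: bl_addr_ge0. Qed.

Definition pos_part x : Y := Order.join x 0.

Lemma pos_part_ge0 x : 0 <= pos_part x. Proof. exact: leUr. Qed.

Lemma pos_part_id x : 0 <= x -> pos_part x = x.
Proof. by move=> x0; rewrite /pos_part; apply/join_idPl. Qed.

Definition modulus x : Y := Order.join x (- x).

Lemma modulus_ge0 x : 0 <= modulus x.
Proof.
have : 0 <= modulus x + modulus x.
  by rewrite -(subrr x); apply: bl_leD; [exact: leUl|exact: leUr].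
rewrite -mulr2n -scaler_nat => /(@bl_scale_ge0 2^-1).
by rewrite scalerA mulVf ?pnatr_eq0// scale1r invr_ge0; apply.
Qed.

(** Equivalently, [x <= y + (x - y) <= pos_part y + modulus (x - y)]. *)
Lemma pos_part_lip_le x y : pos_part x - pos_part y <= modulus (x - y).
Proof.
rewrite -bl_subr_ge0 opprB addrA bl_subr_ge0.
rewrite leUx; apply/andP; split.
  by rewrite -[leLHS](subrK y); apply: bl_leD; exact: leUl.
by apply: bl_addr_ge0; [exact: modulus_ge0|exact: pos_part_ge0].
Qed.

Lemma pos_part_lip x y : `|pos_part x - pos_part y| <= `|x - y|.
Proof.
apply: bl_le_norm.
change (modulus (pos_part x - pos_part y) <= modulus (x - y)).
rewrite leUx pos_part_lip_le/= opprB.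
have -> : modulus (x - y) = modulus (y - x).
  by rewrite /modulus joinC !opprB.
exact: pos_part_lip_le.
Qed.

(** The positive cone is the fixed set of the continuous map [pos_part]. *)
Lemma cone_cvg (u : nat -> Y) l : (forall k, 0 <= u k) ->
  u k @[k --> \oo] --> l -> 0 <= l.
Proof.
move=> u0 ul; suff : u k @[k --> \oo] --> pos_part l.
  by move=> /(cvg_unique _ ul) ->; [exact: pos_part_ge0|exact: norm_hausdorff].
apply/cvgrPdist_lt => e e0; move/cvgrPdist_lt/(_ e e0): ul.
apply: filterS => k; apply: le_lt_trans.
by rewrite -{1}(pos_part_id (u0 k)); exact: pos_part_lip.
Qed.

End banach_lattice.

(** * Jensen's inequality *)

Section concave.
Context (R : realType) (Y : banachLatticeType R).
Variable U : Y -> R.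

Definition cone_concave := forall (x y : Y) (l : R), 0 <= x -> 0 <= y ->
  0 <= l <= 1 -> l * U x + (1 - l) * U y <= U (l *: x + (1 - l) *: y).

Hypothesis Uconc : cone_concave.

(** The perspective [(a, x) |-> a * U (a^-1 *: x)] of a concave function is
    superadditive. The hypotheses on zero weights give it the value 0 there, so
    that sums with vanishing weights need no separate treatment. *)
Lemma perspective_superadd (a b : R) (x y : Y) : 0 <= a -> 0 <= b ->
  0 <= x -> 0 <= y -> (a = 0 -> x = 0) -> (b = 0 -> y = 0) ->
  a * U (a^-1 *: x) + b * U (b^-1 *: y) <= (a + b) * U ((a + b)^-1 *: (x + y)).
Proof.
move=> a0 b0 x0 y0 ax0 by0.
have [a_0|aN0] := eqVneq a 0; first by rewrite ax0// a_0 mul0r !add0r.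
have [b_0|bN0] := eqVneq b 0; first by rewrite by0// b_0 mul0r !addr0.
have ap : 0 < a by rewrite lt0r aN0.
have bp : 0 < b by rewrite lt0r bN0.
have abp : 0 < a + b by exact: addr_gt0.
have abN0 : a + b != 0 by rewrite gt_eqF.
have l01 : 0 <= a / (a + b) <= 1.
  by rewrite divr_ge0 ?(ltW abp)//= ler_pdivrMr// mul1r lerDl.
have := @Uconc (a^-1 *: x) (b^-1 *: y) (a / (a + b)).
rewrite !bl_scale_ge0 ?invr_ge0// => /(_ isT isT l01).
have -> : 1 - a / (a + b) = b / (a + b) by field.
have ea : a / (a + b) * a^-1 = (a + b)^-1 by field; rewrite abN0.
have eb : b / (a + b) * b^-1 = (a + b)^-1 by field; rewrite abN0.
rewrite !scalerA ea eb -scalerDr.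
rewrite -(ler_pM2l abp); apply: le_trans; rewrite le_eqVlt; apply/orP; left.
by apply/eqP; field.
Qed.

Lemma finite_jensen (I : Type) (r : seq I) (w : I -> R) (x : I -> Y) :
  (forall i, 0 <= w i) -> (forall i, 0 <= x i) ->
  \sum_(i <- r) w i * U (x i)
  <= (\sum_(i <- r) w i) *
     U ((\sum_(i <- r) w i)^-1 *: \sum_(i <- r) w i *: x i).
Proof.
move=> w0 x0.
suff : [/\ 0 <= \sum_(i <- r) w i, 0 <= \sum_(i <- r) w i *: x i,
    \sum_(i <- r) w i = 0 -> \sum_(i <- r) w i *: x i = 0 &
    \sum_(i <- r) w i * U (x i) <= (\sum_(i <- r) w i) *
     U ((\sum_(i <- r) w i)^-1 *: \sum_(i <- r) w i *: x i)] by case.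
elim: r => [|i r [s0 v0 sv IH]]; first by rewrite !big_nil mul0r; split.
rewrite !big_cons; split.
- exact: addr_ge0.
- by apply: bl_addr_ge0 => //; exact: bl_scale_ge0.
- move=> /eqP; rewrite paddr_eq0// => /andP[/eqP -> /eqP /sv ->].
  by rewrite scale0r addr0.
have [wi0|wiN0] := eqVneq (w i) 0; first by rewrite wi0 mul0r scale0r !add0r.
apply: le_trans (perspective_superadd _ _ _ _ _ sv) => //.
- by rewrite lerD// scalerA mulVf// scale1r.
- exact: bl_scale_ge0.
- by move=> /eqP; rewrite (negbTE wiN0).
Qed.

End concave.

Section positive_integral.
Context d (T : measurableType d) (R : realType) (Y : banachLatticeType R).
Variable mu : {measure set T -> \bar R}.
Variables (D : set T) (mD : measurable D) (fD : (mu D < +oo)%E).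

(** As [f] is its own positive part, taking positive parts brings the simple
    functions no further from [f]. *)
Lemma pos_approx (f : T -> Y) (s : nat -> {fimfun T >-> Y}) :
  (forall t, D t -> 0 <= f t) -> bochner_approx mu D f s ->
  bochner_approx mu D f (fun k => @pos_part R Y \o s k).
Proof.
move=> f0 fs; apply: (le_approx mD fD fs) => [k|t k Dt].
  exact: simple_on_comp (approx_simple k fs).
by rewrite -{1}(pos_part_id (f0 t Dt)); exact: pos_part_lip.
Qed.

Lemma simple_integral_pos (s : {fimfun T >-> Y}) : simple_on D s ->
  0 <= simple_integral mu D (@pos_part R Y \o s).
Proof.
move=> sD; rewrite simple_integral_comp//; apply: bl_sum_ge0 => z _.
by apply: bl_scale_ge0; [exact: level_ge0|exact: pos_part_ge0].
Qed.

Lemma bochner_integral_ge0 (f : T -> Y) : bochner_integrable mu D f ->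
  (forall t, D t -> 0 <= f t) -> 0 <= bochner_integral mu D f.
Proof.
move=> [s fs] f0.
apply: cone_cvg (bochner_integral_cvg mD fD (pos_approx f0 fs)).
by move=> k; apply: simple_integral_pos; exact: approx_simple k fs.
Qed.

Let m := fine (mu D).

Definition mean (f : T -> Y) : Y := m^-1 *: bochner_integral mu D f.

Lemma mean_ge0 (f : T -> Y) : bochner_integrable mu D f ->
  (forall t, D t -> 0 <= f t) -> 0 <= mean f.
Proof.
move=> fi f0; apply: bl_scale_ge0; last exact: bochner_integral_ge0.
by rewrite invr_ge0; exact/fine_ge0.
Qed.

(** True on a null set too, where both sides vanish. *)
Lemma scale_mean (f : T -> Y) : bochner_integrable mu D f ->
  m *: mean f = bochner_integral mu D f.
Proof.
move=> fi; rewrite /mean scalerA; have [m0|mN0] := eqVneq m 0; last first.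
  by rewrite divff// scale1r.
rewrite m0 mul0r scale0r bochner_integral_null//.
rewrite -(fineK (_ : mu D \is a fin_num)) -/m ?m0//.
by rewrite ge0_fin_numE.
Qed.

Hypothesis D0 : (0 < mu D)%E.

Let m_gt0 : 0 < m.
Proof. by apply: fine_gt0; rewrite D0. Qed.

Lemma limn_einf_le_cvg (u v : (\bar R)^nat) (l : \bar R) :
  (forall k, u k <= v k)%E -> v k @[k --> \oo] --> l -> (limn_einf u <= l)%E.
Proof.
move=> uv vl; rewrite limn_einf_lim -(cvg_lim _ vl)//; apply: lee_lim.
- exact: is_cvg_einfs.
- by apply/cvg_ex; exists l.
apply: nearW => k; apply: le_trans (uv k); apply: ereal_inf_lbound.
by exists k => //=.
Qed.

(** For nonnegative simple functions this is [finite_jensen]. Along a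
    nonnegative approximating sequence the right-hand sides converge by
    continuity of [U], and Fatou's lemma bounds the limit on the left.
    Subtracting [U 0] makes the integrands nonnegative, so that integrability
    of [U \o f] is part of the conclusion. *)
Lemma integral_jensen (U : Y -> R) (f : T -> Y) :
  {within [set y : Y | 0 <= y], continuous U} -> cone_concave U ->
  (forall y, 0 <= y -> U 0 <= U y) ->
  bochner_integrable mu D f -> (forall t, D t -> 0 <= f t) ->
  exists N, [/\ measurable N, mu N = 0%E,
    measurable_fun (D `\` N) (U \o f) &
    (\int[mu]_(t in D `\` N) (U (f t) - U 0)%:E
     <= (m * (U (mean f) - U 0))%:E)%E].
Proof.
move=> Uc Uconc U0 fi f0; case: (fi) => s fs.
have sD k : simple_on D (s k) := approx_simple k fs.
pose p k : {fimfun T >-> Y} := @pos_part R Y \o s k.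
have fp : bochner_approx mu D f p := pos_approx f0 fs.
have [N [mN N0 pf]] := approx_cvg_off_null fp.
have mD' : measurable (D `\` N) by exact: measurableD.
have D'D : D `\` N `<=` D by exact: subDsetl.
have pD k : simple_on D (p k) := approx_simple k fp.
have pD' k : simple_on (D `\` N) (p k) := simple_on_sub mD' D'D (pD k).
have p0 k t : 0 <= p k t by exact: pos_part_ge0.
have Ucvg (u : nat -> Y) (l : Y) : (forall k, 0 <= u k) -> 0 <= l ->
    u k @[k --> \oo] --> l -> U (u k) @[k --> \oo] --> U l.
  move=> u0 l0 ul; move/subspace_continuousP: Uc => /(_ l l0).
  apply: (@cvg_comp _ _ _ u) => A lA.
  have : \forall k \near \oo, 0 <= u k -> A (u k) := ul _ lA.
  by apply: filterS => k; apply.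
have UpUf t : (D `\` N) t -> U (p k t) @[k --> \oo] --> U (f t).
  by move=> D't; apply: Ucvg => //; [exact/f0/D'D|exact: pf].
exists N; split=> //.
  apply: (measurable_fun_cvg (h := fun k t => U (p k t))) => // k.
  exact: (simple_on_measurable U (pD' k)).
have := @fatou _ _ _ mu _ mD' (fun k t => (U (p k t) - U 0)%:E).
set L := limn_einf (fun k => _) => /(_ _ _)/le_trans.
rewrite (eq_integral (fun t => (U (f t) - U 0)%:E)); last first.
  move=> t; rewrite inE => D't.
  have /cvg_limn_einf_sup[-> _]// : (U (p k t) - U 0)%:E @[k --> \oo] -->
      (U (f t) - U 0)%:E.
  by apply: cvg_EFin; [exact: nearW|apply: cvgB; [exact: UpUf|exact: cvg_cst]].
apply.
- move=> k; apply/measurable_EFinP.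
  exact: (simple_on_measurable (fun z => U z - U 0) (pD' k)).
- by move=> k t _; rewrite lee_fin subr_ge0 U0.
apply: (limn_einf_le_cvg (v := fun k =>
    (m * (U (m^-1 *: simple_integral mu D (p k)) - U 0))%:E)).
  move=> k.
  apply: (@le_trans _ _ (\int[mu]_(t in D) (U (pos_part (s k t)) - U 0)%:E)%E).
    apply: le_lower_integral => // t _; rewrite lee_fin subr_ge0 U0//.
    exact: pos_part_ge0.
  rewrite (integral_simple mD fD (phi := fun z => U (pos_part z) - U 0) (sD k)).
    rewrite lee_fin (simple_integral_comp mD fD _ (sD k)).
    under eq_bigr do rewrite mulrBr.
    have mE : \sum_(z <- fset_set (range (s k))) level mu D (s k) z = m.
      exact: (sum_level mD fD (sD k)).
    rewrite sumrB -mulr_suml mE mulrBr lerB// -[in leRHS]mE.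
    by apply: finite_jensen => // z; [exact: level_ge0|exact: pos_part_ge0].
  by move=> z; rewrite subr_ge0 U0 ?pos_part_ge0.
apply: cvg_EFin; first exact: nearW.
apply: cvgMr => //; apply: cvgB; last exact: cvg_cst.
apply: Ucvg => //.
- move=> k; apply: bl_scale_ge0; first by rewrite invr_ge0 ltW.
  exact: simple_integral_pos.
- exact: mean_ge0.
by apply: cvgZr; exact: bochner_integral_cvg.
Qed.

End positive_integral.

Section strict_jensen.
Context d (T : measurableType d) (R : realType) (Y : banachLatticeType R).
Variable mu : {measure set T -> \bar R}.
Variables (D : set T) (mD : measurable D) (fD : (mu D < +oo)%E).
Hypothesis D0 : (0 < mu D)%E.
Let m := fine (mu D).

Lemma measure0_integral_le (D' : set T) (K : T -> R) : measurable D' ->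
  measurable_fun D' K -> (forall t, D' t -> 0 < K t) ->
  (\int[mu]_(t in D') (K t)%:E <= 0)%E -> mu D' = 0%E.
Proof.
move=> mD' mK K0 K_le0.
have /ae_eq_integral_abs[]// : (\int[mu]_(t in D') `|(K t)%:E| = 0)%E.
- apply/eqP; rewrite eq_le integral_ge0// andbT.
  rewrite (eq_integral (fun t => (K t)%:E)) => // t.
  by rewrite inE => /K0 Kt; rewrite gee0_abs// lee_fin ltW.
- exact/measurable_EFinP.
move=> N [mN N0 subN]; apply: (subset_measure0 mD' mN _ N0) => t D't.
apply: subN => /= /(_ D't) [Kt0].
by have := K0 t D't; rewrite Kt0 ltxx.
Qed.

(** Jensen's inequality is used for each coordinate [w] and summed. If the
    conclusion failed, the integral of the positive function
    [\sum_w U w (G t w) * q w - c] would be at most 0. *)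
Lemma strict_jensen (Omega : finType) (U : Omega -> Y -> R) (q : Omega -> R)
    (G : T -> Omega -> Y) (c : R) :
  (forall w, {within [set y : Y | 0 <= y], continuous (U w)}) ->
  (forall w, cone_concave (U w)) ->
  (forall w y, 0 <= y -> U w 0 <= U w y) ->
  (forall w, 0 <= q w) ->
  (forall w, bochner_integrable mu D (G ^~ w)) ->
  (forall t w, D t -> 0 <= G t w) ->
  (forall t, D t -> c < \sum_w U w (G t w) * q w) ->
  c < \sum_w U w (mean mu D (G ^~ w)) * q w.
Proof.
move=> Uc Uconc U0 q0 Gi G0 cG; rewrite ltNge; apply/negP => Gc.
have m0 : 0 < m by apply: fine_gt0; rewrite D0.
have /choice[N HN] : forall w, exists N, [/\ measurable N, mu N = 0%E,
    measurable_fun (D `\` N) (U w \o G ^~ w) &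
    (\int[mu]_(t in D `\` N) (U w (G t w) - U w 0)%:E
     <= (m * (U w (mean mu D (G ^~ w)) - U w 0))%:E)%E].
  move=> w; apply: (integral_jensen mD fD D0 (Uc w) (Uconc w) (U0 w) (Gi w)).
  by move=> t Dt; exact: G0.
pose N0 := \big[setU/set0]_(w : Omega) N w.
have mN0 : measurable N0 by apply: bigsetU_measurable => w _; case: (HN w).
have N00 : mu N0 = 0%E.
  suff : measurable N0 /\ mu N0 = 0%E by case.
  rewrite /N0; elim/big_ind : _ => //= [A B [mA A0] [mB B0]|w _].
    by split; [exact: measurableU|rewrite measureU0].
  by have [] := HN w.
set D' := D `\` N0.
have mD' : measurable D' by exact: measurableD.
have D'D w : D' `<=` D `\` N w.
  move=> t [Dt N0t]; split=> // Nt; apply: N0t.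
  by rewrite /N0 (bigD1 w)//=; left.
have D'mu : mu D' = mu D.
  rewrite (measureDI mu mD mN0).
  rewrite (@subset_measure0 _ _ _ mu (D `&` N0) N0) ?adde0//.
  exact: measurableI.
pose h w t := U w (G t w) - U w 0.
have mh w : measurable_fun D' (h w).
  apply: measurable_funB; last exact: measurable_cst.
  have [mNw _ + _] := HN w; apply: measurable_funS => //.
  exact: measurableD.
have h0 w t : D' t -> 0 <= h w t.
  by move=> [Dt _]; rewrite subr_ge0 U0// G0.
pose C := c - \sum_w U w 0 * q w.
pose K t := \sum_w h w t * q w - C.
have K0 t : D' t -> 0 < K t.
  move=> [Dt _]; rewrite /K /C opprB addrA.
  under eq_bigr do rewrite mulrBl.
  by rewrite sumrB subrK subr_gt0 cG.
have C0 : 0 <= C.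
  apply: (@le_trans _ _ (\sum_w (U w (mean mu D (G ^~ w)) - U w 0) * q w)).
    apply: sumr_ge0 => w _; rewrite mulr_ge0// subr_ge0 U0//.
    by apply: mean_ge0 => // t; exact: G0.
  by under eq_bigr do rewrite mulrBl; rewrite sumrB lerB.
have mK : measurable_fun D' K.
  apply: measurable_funB; last exact: measurable_cst.
  by apply: measurable_sum => w; exact: measurable_funM.
suff : mu D' = 0%E by rewrite D'mu => D_0; move: D0; rewrite D_0 ltxx.
apply: (@measure0_integral_le _ K) => //.
have : (\int[mu]_(t in D') (K t + C)%:E <= (m * C)%:E)%E.
  rewrite (eq_integral (fun t => \sum_w (h w t * q w)%:E)%E); last first.
    by move=> t _; rewrite sumEFin /K subrK.
  rewrite ge0_integral_sum//; last 2 first.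
    move=> w; apply/measurable_EFinP.
    by apply: measurable_funM => //; exact: measurable_cst.
    by move=> w t D't; rewrite lee_fin mulr_ge0// h0.
  apply: (@le_trans _ _
      (\sum_w (m * (U w (mean mu D (G ^~ w)) - U w 0) * q w)%:E)%E).
    apply: lee_sum => w _; under eq_integral do rewrite EFinM.
    rewrite ge0_integralZr//; last 3 first.
      exact/measurable_EFinP.
      by move=> t D't; rewrite lee_fin h0.
      by rewrite lee_fin.
    rewrite EFinM lee_wpmul2r ?lee_fin//.
    have [_ _ _] := HN w; apply: le_trans; apply: le_lower_integral => //.
      by move=> t [Dt _]; rewrite lee_fin subr_ge0 U0// G0.
      by move=> t D't; rewrite lee_fin h0.
  rewrite sumEFin lee_fin.
  under eq_bigr do rewrite -mulrA mulrBl.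
  by rewrite -mulr_sumr sumrB ler_pM2l// lerB.
under eq_integral do rewrite EFinD.
rewrite ge0_integralD//; last 2 first.
  by move=> t D't; rewrite lee_fin ltW// K0.
  exact/measurable_EFinP.
rewrite integral_cst// D'mu -(fineK (_ : mu D \is a fin_num)); last first.
  by rewrite ge0_fin_numE.
rewrite -EFinM mulrC -/m -[leRHS]add0e leeD2rE//.
Qed.

End strict_jensen.

(** * Blocking plans of a finite economy *)

Section finite_economy.
Context (R : realType) (Y : banachLatticeType R) (Omega : finType) (n : nat).
Variable E : economy Y Omega n.
Implicit Types (i j : 'I_n.+1) (w : Omega) (x : Omega -> Y).

Lemma consumption_add i x y :
  consumption_set E i x -> consumption_set E i y ->
  consumption_set E i (fun w => x w + y w).
Proof.
move=> [x0 xi] [y0 yi]; split=> [w|B BE w w' wB w'B]; first exact: bl_addr_ge0.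
by rewrite (xi _ BE _ _ wB w'B) (yi _ BE _ _ wB w'B).
Qed.

Lemma consumption_scale i x (a : R) : 0 <= a ->
  consumption_set E i x -> consumption_set E i (fun w => a *: x w).
Proof.
move=> a0 [x0 xi]; split=> [w|B BE w w' wB w'B]; first exact: bl_scale_ge0.
by rewrite (xi _ BE _ _ wB w'B).
Qed.

Lemma consumption_cst i (y : Y) : 0 <= y -> consumption_set E i (fun=> y).
Proof. by move=> y0; split. Qed.

Lemma ex_ante_concave i x y (l : R) : concavity E ->
  consumption_set E i x -> consumption_set E i y -> 0 <= l <= 1 ->
  l * ex_ante E i x + (1 - l) * ex_ante E i y
  <= ex_ante E i (fun w => l *: x w + (1 - l) *: y w).
Proof.
move=> Econ [x0 _] [y0 _] l01; rewrite /ex_ante !mulr_sumr -big_split/=.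
apply: ler_sum => w _; rewrite !mulrA -mulrDl ler_wpM2r//.
  exact/ltW/prior_gt0.
exact: Econ.
Qed.

Lemma ex_ante_mono i x (y : Y) : monotonicity E ->
  consumption_set E i x -> 0 < y ->
  ex_ante E i x < ex_ante E i (fun w => x w + y).
Proof.
move=> Emon [x0 _] y0; rewrite /ex_ante.
have [w _] : exists w : Omega, true.
  apply: contrapT => noO; have := @oner_eq0 R; rewrite -(prior_sum1 E i) big1.
    by rewrite eqxx.
  by move=> w _; exfalso; apply: noO; exists w.
rewrite (bigD1 w)//= [ltRHS](bigD1 w)//= ltr_leD//.
  by rewrite ltr_pM2r ?prior_gt0//; exact: Emon.
apply: ler_sum => w' _; rewrite ler_pM2r ?prior_gt0//.
exact/ltW/Emon.
Qed.

(** The default value 0 of [infimum] is excluded by strict positivity, so the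
    infimum is a genuine lower bound. *)
Lemma strong_positivity_lbound i : strong_positivity E ->
  exists2 z : Y, 0 < z & forall w, z <= endow E i w.
Proof.
move=> /(_ i) z0; exists (infimum 0 (range (endow E i))) => // w.
move: z0; rewrite /infimum; case: ifPn => [_|_]; first by rewrite ltxx.
have [[z zP]|noz] := pselect (exists z, infimums (range (endow E i)) z).
  by move=> _; have [+ _] := xgetPex 0 (ex_intro _ z zP); apply; exists w.
rewrite xgetPN ?ltxx// => z zP; by apply: noz; exists z.
Qed.

(** By concavity, [(1 - e) *: v i] is worth at least
    [(1 - e) * V (v i) + e * V 0], which exceeds [V (u i)] for small [e]. *)
Lemma shrink_consumption (s : 'I_n.+1 -> R) (u v : 'I_n.+1 -> Omega -> Y) :
  concavity E -> (forall i, consumption_set E i (v i)) ->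
  (forall i, 0 < s i -> ex_ante E i (u i) < ex_ante E i (v i)) ->
  exists2 e : R, 0 < e < 1 & forall i, 0 < s i ->
    ex_ante E i (u i) < ex_ante E i (fun w => (1 - e) *: v i w).
Proof.
move=> Econ vC uv.
have : \forall e \near (0 : R)^'+, [/\ 0 < e, e < 1 & forall i, 0 < s i ->
    e * (ex_ante E i (v i) - ex_ante E i (fun=> 0))
    < ex_ante E i (v i) - ex_ante E i (u i)].
  near=> e; split.
  - by near: e; exact: nbhs_right_gt.
  - by near: e; exact: nbhs_right_lt.
  near: e; apply: filter_forall => i.
  have [si0|/negP si0] := boolP (0 < s i); last by apply: nearW.
  set a := _ - ex_ante E i (u i); have a0 : 0 < a by rewrite subr_gt0 uv.
  set b := _ - _; have b0 : 0 < 1 + `|b| by rewrite ltr_pwDl.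
  near=> e => _; have e0 : 0 < e by near: e; exact: nbhs_right_gt.
  apply: (@le_lt_trans _ _ (e * `|b|)); first by rewrite ler_pM2l// ler_norm.
  apply: (@lt_trans _ _ (e * (1 + `|b|))); first by rewrite ltr_pM2l// ltrDr.
  rewrite -ltr_pdivlMr//; near: e; apply: nbhs_right_lt.
  exact: divr_gt0.
move=> /filter_ex[e [e0 e1 He]]; exists e; rewrite ?e0// => i si0.
have zC : consumption_set E i (fun=> 0) by exact: consumption_cst.
have e01 : 0 <= 1 - e <= 1 by rewrite subr_ge0 ltW//= gerBl ltW.
apply: lt_le_trans (_ : ex_ante E i
    (fun w => (1 - e) *: v i w + (1 - (1 - e)) *: 0) <= _).
  apply: lt_le_trans (ex_ante_concave Econ (vC i) zC e01).
  by have := He i si0; lra.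
by under [X in ex_ante _ _ X <= _]funext do rewrite scaler0 addr0.
Unshelve. all: by end_near. Qed.

(** The plan [v] blocks [u] with sizes [s]; the plan [h] does so with sizes
    [m i = alpha * s i + beta / (n + 1)] of total [eps]. Within type [i] it is
    the average, with weights proportional to the two terms of [m i], of the
    scaled down plan [g i] and of [k i], which is [u i] plus a share [y] of the
    surplus. All [m i] are positive, so every type takes part. *)
Lemma blocking_any_size (s : 'I_n.+1 -> R) (u v : 'I_n.+1 -> Omega -> Y)
    (eps : R) :
  monotonicity E -> concavity E -> strong_positivity E ->
  (forall i, consumption_set E i (u i)) ->
  (forall w, \sum_i n.+1%:R^-1 *: u i w
             <= \sum_i n.+1%:R^-1 *: endow E i w) ->
  (forall i, 0 <= s i <= n.+1%:R^-1) -> 0 < \sum_i s i ->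
  (forall i, consumption_set E i (v i)) ->
  (forall i, 0 < s i -> ex_ante E i (u i) < ex_ante E i (v i)) ->
  (forall w, \sum_i s i *: v i w <= \sum_i s i *: endow E i w) ->
  0 < eps < 1 ->
  exists (m : 'I_n.+1 -> R) (h : 'I_n.+1 -> Omega -> Y),
    [/\ forall i, 0 < m i <= n.+1%:R^-1, \sum_i m i = eps,
        forall i, consumption_set E i (h i),
        forall i, ex_ante E i (u i) < ex_ante E i (h i) &
        forall w, \sum_i m i *: h i w <= \sum_i m i *: endow E i w].
Proof.
move=> Emon Econ Epos uC u_feas s01 s_gt0 vC uv v_feas /andP[eps0 eps1].
have [e /andP[e0 e1] He] := shrink_consumption Econ vC uv.
have s0 i : 0 <= s i by case/andP: (s01 i).
have [j sj0] : exists j, 0 < s j.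
  apply: contrapT => no; move: s_gt0; rewrite big1 ?ltxx// => i _.
  apply/eqP; rewrite eq_le s0 andbT leNgt; apply/negP => si; apply: no.
  by exists i.
have [z0 z0_gt0 z0_le] := strong_positivity_lbound j Epos.
set sigma := \sum_i s i in s_gt0 *.
pose nu : R := n.+1%:R^-1.
have nu0 : 0 < nu by rewrite invr_gt0.
have nu_sum : \sum_(i < n.+1) nu = 1.
  by rewrite sumr_const card_ord -mulr_natl divff.
have sigma1 : sigma <= 1.
  by rewrite -nu_sum; apply: ler_sum => i _; case/andP: (s01 i).
(* any positive [alpha] that is at most [1 - eps], for [alpha + beta <= 1], and
   less than [eps], for [beta > 0], will do *)
pose alpha := eps * (1 - eps) / 2.
have alpha0 : 0 < alpha by rewrite divr_gt0// mulr_gt0// subr_gt0.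
pose beta := eps - alpha * sigma.
have beta0 : 0 < beta.
  rewrite /beta subr_gt0 (@le_lt_trans _ _ alpha)//.
    by rewrite ler_piMr// ltW.
  by rewrite /alpha; nra.
have ab1 : alpha + beta <= 1.
  have : 0 <= alpha * sigma by rewrite mulr_ge0 ?ltW.
  by rewrite /beta /alpha; nra.
pose m i := alpha * s i + beta * nu.
have m0 i : 0 < m i.
  by rewrite /m ltr_wpDl ?mulr_gt0// mulr_ge0// ltW.
(* [z] is a lower bound in every state of what the agents of type [j] save when
   the blocking plan is scaled down; it is constant, hence measurable for the
   information of every type *)
pose z := (e * s j) *: z0.
have z_gt0 : 0 < z by rewrite bl_scale_gt0// mulr_gt0.
pose y := (alpha / beta) *: z.
have y_gt0 : 0 < y by rewrite bl_scale_gt0// divr_gt0.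
pose l i := alpha * s i / m i.
have l01 i : 0 <= l i <= 1.
  have as0 : 0 <= alpha * s i by rewrite mulr_ge0// ltW.
  have bn0 : 0 <= beta * nu by rewrite mulr_ge0 ?ltW.
  rewrite divr_ge0 ?(ltW (m0 i))//=.
  by rewrite ler_pdivrMr// mul1r lerDl.
pose g := fun i w => (1 - e) *: v i w.
pose k := fun i w => u i w + y.
have gC : forall i, consumption_set E i (g i).
  by move=> i; apply: consumption_scale => //; rewrite subr_ge0 ltW.
have kC : forall i, consumption_set E i (k i).
  by move=> i; apply: consumption_add => //; apply: consumption_cst; exact: ltW.
pose h := fun i w => l i *: g i w + (1 - l i) *: k i w.
exists m, h; split.
- move=> i; rewrite m0/= -/nu /m.
  have : alpha * s i <= alpha * nu by rewrite ler_pM2l//; case/andP: (s01 i).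
  by nra.
- by rewrite big_split/= -!mulr_sumr nu_sum -/sigma /beta; ring.
- move=> i; have /andP[l0 l1] := l01 i.
  by apply: consumption_add; apply: consumption_scale; rewrite ?subr_ge0.
- move=> i; apply: lt_le_trans (ex_ante_concave Econ (gC i) (kC i) (l01 i)).
  have uk := ex_ante_mono Emon (uC i) y_gt0.
  have /andP[l0 l1] := l01 i.
  have [si0|si0] := ltP 0 (s i); last first.
    have -> : l i = 0.
      rewrite /l (_ : s i = 0) ?mulr0 ?mul0r//.
      by apply/eqP; rewrite eq_le si0 s0.
    by rewrite mul0r add0r subr0 mul1r.
  have li0 : 0 < l i by rewrite divr_gt0// mulr_gt0.
  have : 0 < l i * (ex_ante E i (g i) - ex_ante E i (u i)).
    by rewrite mulr_gt0// subr_gt0 He.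
  have : 0 <= (1 - l i) * (ex_ante E i (k i) - ex_ante E i (u i)).
    by rewrite mulr_ge0// subr_ge0// ltW.
  by lra.
- move=> w.
  have mN0 i : m i != 0 by rewrite gt_eqF.
  have mh i : m i *: h i w
      = (alpha * (1 - e)) *: (s i *: v i w) + beta *: (nu *: u i w)
        + (beta * nu) *: y.
    have ml : m i * l i = alpha * s i by rewrite /l mulrC divfK.
    have ml' : m i * (1 - l i) = beta * nu.
      by rewrite mulrBr mulr1 ml /m addrAC subrr add0r.
    rewrite /h scalerDr !scalerA ml ml' /g /k scalerDr !scalerA addrA.
    by congr (_ *: _ + _ + _); ring.
  have me i : m i *: endow E i w
      = alpha *: (s i *: endow E i w) + beta *: (nu *: endow E i w).
    by rewrite /m scalerDl !scalerA.
  under eq_bigr do rewrite mh.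
  under [leRHS]eq_bigr do rewrite me.
  rewrite !big_split/= -scaler_suml -[\sum_i beta * nu]mulr_sumr nu_sum mulr1.
  rewrite -!scaler_sumr.
  rewrite addrAC; apply: bl_leD; last first.
    by apply: bl_scale_le; [exact: ltW|rewrite !scaler_sumr; exact: u_feas].
  rewrite /y scalerA mulrCA divff ?gt_eqF// mulr1 -scalerA -scalerDr.
  apply: bl_scale_le; first exact: ltW.
  have -> : \sum_i s i *: endow E i w = (1 - e) *: \sum_i s i *: endow E i w
      + e *: \sum_i s i *: endow E i w by rewrite -scalerDl subrK scale1r.
  apply: bl_leD; first by apply: bl_scale_le => //; rewrite subr_ge0 ltW.
  rewrite /z -scalerA; apply: bl_scale_le; first exact: ltW.
  rewrite (bigD1 j)//= -[leLHS]addr0; apply: bl_leD.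
    by apply: bl_scale_le => //; exact: ltW.
  by apply: bl_sum_ge0 => i _; apply: bl_scale_ge0 => //; exact: endow_ge0.
Qed.

End finite_economy.

(** * The intervals of types *)

Section agent_types.
Context (R : realType) (n : nat).
Implicit Types (i j : 'I_n.+1) (t : R) (S : set R).

Let mu : {measure set (measurableTypeR R) -> \bar R} := lebesgue_measure.
Let N : R := n.+1%:R.
Let N_gt0 : 0 < N. Proof. by rewrite ltr0n. Qed.

(** Clearing denominators turns membership into comparisons of [t * N] with
    integers. *)
Lemma agents_of_typeP i t : agents_of_type i t <->
  i%:R <= t * N /\ (if i == ord_max then t <= 1 else t * N < i.+1%:R).
Proof.
rewrite /agents_of_type; case: ifP => _ /=.
  by rewrite in_itv/= ler_pdivrMr//; split => [/andP|] [] => [|-> ->].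
by rewrite in_itv/= ler_pdivrMr// ltr_pdivlMr//;
  split => [/andP|] [] => [|-> ->].
Qed.

Lemma agents_of_type_sub i : agents_of_type i `<=` @agents R.
Proof.
move=> t /agents_of_typeP[it ti]; rewrite /agents /= in_itv/=.
have t0 : 0 <= t * N by apply: le_trans it; rewrite ler0n.
rewrite -(pmulr_lge0 _ N_gt0) t0/=; move: ti; case: ifP => // _ ti.
rewrite -(ler_pM2r N_gt0) mul1r (le_trans (ltW ti))// ler_nat.
exact: ltn_ord.
Qed.

Lemma agents_of_type_lt i j t : (i < j)%N ->
  agents_of_type i t -> agents_of_type j t -> False.
Proof.
move=> ij /agents_of_typeP[_ ti] /agents_of_typeP[jt _].
have iN : (i == ord_max) = false.
  apply/negP => /eqP iE; move: ij; rewrite iE ltnNge -ltnS.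
  by rewrite ltn_ord.
move: ti; rewrite iN => /(le_lt_trans jt); rewrite ltr_nat ltnS => ji.
by move: ij; rewrite ltnNge ji.
Qed.

Lemma agents_of_type_inj i j t :
  agents_of_type i t -> agents_of_type j t -> i = j.
Proof.
move=> it jt; have [ij|ji|/val_inj //] := ltngtP i j; exfalso.
  exact: agents_of_type_lt ij it jt.
exact: agents_of_type_lt ji jt it.
Qed.

Lemma type_of_exists t : agents t -> exists i, agents_of_type i t.
Proof.
rewrite /agents /= in_itv/= => /andP[t0 t1].
have tN0 : 0 <= t * N by rewrite mulr_ge0// ltW.
have /andP[kt tk] := truncn_itv tN0.
set k := Num.truncn _ in kt tk.
have [kn|nk] := ltnP k n.
  have kE : (inord k : 'I_n.+1) = k :> nat by rewrite inordK// ltnS ltnW.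
  exists (inord k); apply/agents_of_typeP; rewrite kE; split => //.
  by case: ifP.
exists ord_max; apply/agents_of_typeP; rewrite eqxx; split=> //=.
by apply: le_trans kt; rewrite ler_nat.
Qed.

Lemma type_ofE i t : agents_of_type i t -> type_of n t = i.
Proof.
move=> it; have : agents_of_type (type_of n t) t.
  by apply: (@xgetPex _ ord0 [set i | agents_of_type i t]); exists i.
by move/agents_of_type_inj; apply.
Qed.

Lemma type_ofP t : agents t -> agents_of_type (type_of n t) t.
Proof. by move=> /type_of_exists[i it]; rewrite (type_ofE it). Qed.

Lemma fiber_type_of S i : S `<=` @agents R ->
  fiber S (type_of n) i = S `&` agents_of_type i.
Proof.
move=> SA; apply/seteqP; split=> t [St].
  by move=> /= <-; split=> //; exact/type_ofP/SA.
by move=> /type_ofE.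
Qed.

Lemma measurable_agents_of_type i :
  measurable (agents_of_type i : set (measurableTypeR R)).
Proof. by rewrite /agents_of_type; case: ifP => _; exact: measurable_itv. Qed.

Lemma measurable_agents : measurable (@agents R : set (measurableTypeR R)).
Proof. exact: measurable_itv. Qed.

Lemma simple_on_type_of S : measurable (S : set (measurableTypeR R)) ->
  S `<=` @agents R ->
  simple_on (S : set (measurableTypeR R)) (type_of n).
Proof.
move=> mS SA i; have := fiber_type_of i SA; rewrite /fiber => ->.
by apply: measurableI => //; exact: measurable_agents_of_type.
Qed.

Lemma mu_itv (a b : R) (c e : bool) : a < b ->
  mu [set` Interval (BSide c a) (BSide e b)] = (b - a)%:E.
Proof.
move=> ab; have := lebesgue_measure_itv (Interval (BSide c a) (BSide e b)).
by rewrite /= lte_fin ab.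
Qed.

Lemma mu_agents_of_type i : mu (agents_of_type i) = (N^-1)%:E.
Proof.
have iN : i%:R / N < i.+1%:R / N by rewrite ltr_pM2r ?invr_gt0// ltr_nat.
have E : (i.+1%:R / N - i%:R / N) = N^-1.
  by rewrite -mulrBl -natrB// subSnn mul1r.
rewrite /agents_of_type; case: ifP => [/eqP iE|_]; last by rewrite mu_itv// E.
have N1 : i.+1%:R / N = 1 by rewrite iE/= divff// gt_eqF.
have -> : `[i%:R / n.+1%:R, 1]%classic
    = [set` Interval (BSide true (i%:R / N)) (BSide false (i.+1%:R / N))].
  by rewrite N1.
by rewrite mu_itv// E.
Qed.

Lemma mu_agents_fin S : measurable (S : set (measurableTypeR R)) ->
  S `<=` @agents R -> (mu S < +oo)%E.
Proof.
move=> mS SA; apply: (@le_lt_trans _ _ (mu (@agents R))).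
  by apply: le_measure => //; rewrite inE//; exact: measurable_agents.
by rewrite mu_itv// ltry.
Qed.

(** Its agents of type [i] form the first [m i] of the interval of type [i]. *)
Definition initial_coalition (m : 'I_n.+1 -> R) : set R :=
  [set t | exists i, i%:R / N <= t < i%:R / N + m i].

Section initial.
Variable m : 'I_n.+1 -> R.
Hypothesis m01 : forall i, 0 < m i <= N^-1.
Let S := initial_coalition m.

Lemma initial_agents_of_type i t :
  i%:R / N <= t < i%:R / N + m i -> agents_of_type i t.
Proof.
have /andP[m0 m1] := m01 i.
move=> /andP[it ti]; have tS : t < i.+1%:R / N.
  by apply: lt_le_trans ti _; rewrite -natr1 mulrDl mul1r lerD2l.
apply/agents_of_typeP; rewrite -ler_pdivrMr// it; split=> //.
rewrite -ltr_pdivlMr//; case: ifP => // /eqP iE.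
by apply: le_trans (ltW tS) _; rewrite iE divff// gt_eqF.
Qed.

Lemma initial_coalition_sub : S `<=` @agents R.
Proof. by move=> t [i /initial_agents_of_type]; exact: agents_of_type_sub. Qed.

Lemma measurable_initial : measurable (S : set (measurableTypeR R)).
Proof.
rewrite (_ : S = \bigcup_(i in [set: 'I_n.+1])
    [set` `[i%:R / N, i%:R / N + m i[%R]).
  apply: fin_bigcup_measurable; first exact: finite_finset.
  by move=> i _; exact: measurable_itv.
apply/seteqP; split=> [t [i it]|t [i _ it]]; exists i => //=.
Qed.

Lemma mu_initial_fiber i : mu (fiber S (type_of n) i) = (m i)%:E.
Proof.
have /andP[m0 m1] := m01 i.
rewrite fiber_type_of; last exact: initial_coalition_sub.
rewrite (_ : _ `&` _ = [set` `[i%:R / N, i%:R / N + m i[%R]).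
  by rewrite mu_itv ?ltrDl// addrAC subrr add0r.
apply/seteqP; split=> [t [[j jt] it]|t] /=; rewrite in_itv/=.
  by rewrite -(agents_of_type_inj (initial_agents_of_type jt) it).
by move=> it; split; [exists i|exact: initial_agents_of_type].
Qed.

Lemma mu_initial : mu S = (\sum_i m i)%:E.
Proof.
have fS := mu_agents_fin measurable_initial initial_coalition_sub.
rewrite -[LHS]fineK ?ge0_fin_numE//.
rewrite (measure_fibers measurable_initial fS (simple_on_type_of
  measurable_initial initial_coalition_sub)).
by congr EFin; apply: eq_bigr => i _; rewrite mu_initial_fiber.
Qed.

End initial.
End agent_types.

(** * From coalitions to blocking plans *)

Section reduction.
Context (R : realType) (Y : banachLatticeType R) (Omega : finType) (n : nat).
Variable E : economy Y Omega n.
Let mu : {measure set (measurableTypeR R) -> \bar R} := lebesgue_measure.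

Lemma utility0_le i w (y : Y) : monotonicity E -> 0 <= y ->
  utility E i w 0 <= utility E i w y.
Proof.
move=> Emon; rewrite le_eqVlt => /orP[/eqP <-//|y0].
by rewrite -[y]add0r ltW//; exact: Emon.
Qed.

(** The means over the agents of each type inherit all properties of the
    blocking assignment; strict preference is [strict_jensen]. For a type that
    is almost absent from [S], the mean is 0 and nothing is claimed about its
    utility. *)
Lemma blocking_averages (S : set R) (f : R -> Omega -> Y)
    (fi : 'I_n.+1 -> Omega -> Y) :
  continuity E -> monotonicity E -> concavity E ->
  (forall i t, agents_of_type i t -> f t = fi i) ->
  privately_blocks E S f ->
  exists (s : 'I_n.+1 -> R) (v : 'I_n.+1 -> Omega -> Y),
    [/\ forall i, 0 <= s i <= n.+1%:R^-1, 0 < \sum_i s i,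
        forall i, consumption_set E i (v i),
        forall i, 0 < s i -> ex_ante E i (fi i) < ex_ante E i (v i) &
        forall w, \sum_i s i *: v i w <= \sum_i s i *: endow E i w].
Proof.
move=> Ects Emon Econ ffi [[mS SA S0] [g [gi gC gV g_feas]]].
have fS := mu_agents_fin mS SA.
have tauS := simple_on_type_of (n := n) mS SA.
pose P i := fiber S (type_of n) i.
have mP i : measurable (P i : set (measurableTypeR R)).
  exact: measurable_fiber.
have PS i : P i `<=` S by move=> t [].
have fP i : (mu (P i) < +oo)%E by apply: mu_agents_fin => // t /PS/SA.
have giP i w : bochner_integrable mu (P i) (g ^~ w).
  by have [s gs] := gi w; exists s; exact: approx_sub gs.
have g0 i t w : P i t -> 0 <= g t w by move=> /PS/gC[].
pose s i := fine (mu (P i)).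
pose v i w := mean mu (P i) (g ^~ w).
exists s, v; split.
- move=> i; rewrite fine_ge0//= -lee_fin fineK ?ge0_fin_numE//.
  rewrite -(mu_agents_of_type R i) /P fiber_type_of//.
  apply: le_measure; rewrite ?inE//.
    by rewrite -fiber_type_of.
  exact: measurable_agents_of_type.
- by rewrite -measure_fibers// fine_gt0// S0.
- move=> i; split=> [w|B BE w w' wB w'B].
    by apply: mean_ge0 => // t; exact: g0.
  rewrite /v /mean; congr (_ *: _); apply: eq_bochner_integral => t [St ti].
  have := gC t St; rewrite /c_consumption_set (ti : type_of n t = i).
  by case=> _ /(_ B BE w w' wB w'B).
- move=> i si0; rewrite /ex_ante.
  apply: (@strict_jensen _ _ _ _ mu _ (mP i) (fP i) _ _
    (utility E i) (prior E i) g) => //.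
  + by rewrite -[ltRHS]fineK ?lte_fin// ge0_fin_numE.
  + by move=> w x y l; exact: Econ.
  + by move=> w y; exact: utility0_le.
  + by move=> w; exact/ltW/prior_gt0.
  + by move=> t w; exact: g0.
  move=> t [St ti]; have := gV t St; rewrite /c_ex_ante ti.
  by rewrite (ffi i t)// -ti; exact/type_ofP/SA.
- move=> w; under eq_bigr do rewrite scale_mean//.
  rewrite -(bochner_integral_fibers mS fS tauS (gi w)).
  have [_ <-] := bochner_integral_step mS fS (v := fun i => endow E i w) tauS
    (f := c_endow E ^~ w) (fun t _ => erefl).
  exact: g_feas.
Qed.

(** The consumption constraint holds for almost all agents, and every type has
    positive measure. *)
Lemma allocation_consumption (f : R -> Omega -> Y)
    (fi : 'I_n.+1 -> Omega -> Y) i :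
  allocation E f -> (forall i t, agents_of_type i t -> f t = fi i) ->
  consumption_set E i (fi i).
Proof.
move=> [_ [N [mN N0 subN]]] ffi; apply: contrapT => fiC.
have : (mu (agents_of_type i) <= mu N)%E.
  apply: le_measure; rewrite ?inE//; first exact: measurable_agents_of_type.
  move=> t it; apply: subN => /= /(_ (agents_of_type_sub it)).
  by rewrite /c_consumption_set (type_ofE it) (ffi _ _ it).
by rewrite N0 mu_agents_of_type lee_fin leNgt invr_gt0 ltr0n.
Qed.

Lemma feasible_average (f : R -> Omega -> Y) (fi : 'I_n.+1 -> Omega -> Y) w :
  feasible E f -> (forall i t, agents_of_type i t -> f t = fi i) ->
  \sum_i n.+1%:R^-1 *: fi i w <= \sum_i n.+1%:R^-1 *: endow E i w.
Proof.
move=> /(_ w) + ffi.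
have mA := @measurable_agents R; have AA : @agents R `<=` @agents R by [].
have fA := mu_agents_fin mA AA; have tauA := simple_on_type_of (n := n) mA AA.
have muA i : fine (mu (fiber (@agents R) (type_of n) i)) = n.+1%:R^-1.
  rewrite fiber_type_of// (setIidr (@agents_of_type_sub _ _ i)).
  by rewrite mu_agents_of_type.
have fE t : agents t -> f t w = fi (type_of n t) w.
  by move=> /(type_ofP n)/ffi ->.
have [_ ->] := bochner_integral_step mA fA (v := fi ^~ w) tauA fE.
have [_ ->] := bochner_integral_step mA fA (v := fun i => endow E i w) tauA
  (f := c_endow E ^~ w) (fun t _ => erefl).
under eq_bigr do rewrite muA.
by under [leRHS]eq_bigr do rewrite muA.
Qed.

End reduction.

Unset Implicit Arguments.

Theorem theorem3p13 (R : realType) (Y : banachLatticeType R)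
    (Omega : finType) (n : nat) (E : economy Y Omega n) :
  continuity E -> monotonicity E -> concavity E -> strong_positivity E ->
  forall (f : R -> Omega -> Y) (fi : 'I_n.+1 -> Omega -> Y),
    allocation E f -> feasible E f ->
    (forall (i : 'I_n.+1) (t : R), agents_of_type i t -> f t = fi i) ->
    ~ private_core E f ->
    forall eps : R, 0 < eps < 1 ->
    exists S : set R,
      [/\ coalition S, lebesgue_measure S = eps%:E & privately_blocks E S f].
Proof.
move=> Ects Emon Econ Epos f fi f_alloc f_feas ffi f_core eps eps01.
have [S0 S0f] : exists S, privately_blocks E S f.
  by apply: contrapT => /forallNP noS; apply: f_core.
have [s [v [s01 s0 vC vV v_feas]]] := blocking_averages Ects Emon Econ ffi S0f.
have [m [h [m01 m_eps hC hV h_feas]]] := blocking_any_size Emon Econ Epos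
  (fun i => allocation_consumption i f_alloc ffi)
  (fun w => feasible_average w f_feas ffi) s01 s0 vC vV v_feas eps01.
pose S := initial_coalition m.
have SA : S `<=` @agents R := initial_coalition_sub m01.
have mS := measurable_initial m : measurable (S : set (measurableTypeR R)).
have muS : lebesgue_measure S = eps%:E by rewrite -m_eps; exact: mu_initial.
have S_coal : coalition S.
  split=> //; change (0%E < lebesgue_measure S)%E.
  by rewrite muS lte_fin; case/andP: eps01.
exists S; split=> //; split=> //; exists (fun t => h (type_of n t)).
have fS := mu_agents_fin mS SA; have tauS := simple_on_type_of (n := n) mS SA.
have step (x : 'I_n.+1 -> Y) := bochner_integral_step mS fS (v := x) tauS
  (f := fun t => x (type_of n t)) (fun t _ => erefl).
split=> [w|t St|t St|w].
- by have [] := step (h ^~ w).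
- exact: hC.
- by rewrite /c_ex_ante (ffi (type_of n t) t) ?hV//; exact/type_ofP/SA.
have [_ ->] := step (h ^~ w); have [_ ->] := step (endow E ^~ w).
under eq_bigr do rewrite mu_initial_fiber//.
by under [leRHS]eq_bigr do rewrite mu_initial_fiber//.
Qed.
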